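(* Let $p$ be an odd prime such that $2^{p-1} \not\equiv 1 \pmod{p^2}$, and let $r$ be a positive integer. Let $C^H$ be the $\left(p^{2r}, \frac{p^r-1}{2}, \frac{p^r-3}{2}\right)$ disjoint difference family in the additive group of the finite field $\mathbb{F}_{p^{2r}}$ consisting of the cosets in $\mathbb{F}_{p^{2r}}^*$ of the subgroup of $2(p^r+1)$-th powers. Let $E^H$ be the disjoint difference family with the same parameters in the additive group of the Galois ring $\mathrm{GR}(p^2,r)$ given by \[ E^H = \{(1+p\alpha)\mathcal{T}_S^*:\alpha \in \mathcal{T}\} \cup \{p\mathcal{T}_S^*\} \cup \{(1+p\alpha)\mathcal{T}_N^* : \alpha \in \mathcal{T}\} \cup \{p\mathcal{T}_N^*\}. \] If $p^r-1 \equiv 0 \pmod{24}$, then the $2$-$\left(p^{2r}, \frac{p^r-1}{2}, \frac{p^r-3}{2}\right)$ designs $dev(E^H)$ and $dev(C^H)$ are nonisomorphic.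
   Context: $\mathrm{GR}(p^2,r)$ is the Galois ring of characteristic $p^2$ and extension degree $r$, i.e. $\mathbb{Z}_{p^2}[x]/\langle f(x)\rangle$ with $f$ monic of degree $r$ whose reduction modulo $p$ is irreducible in $\mathbb{F}_p[x]$ (unique up to isomorphism, of order $p^{2r}$). Its Teichmüller group $\mathcal{T}^*=\{1,\xi,\dots,\xi^{p^r-2}\}$ is the cyclic subgroup of order $p^r-1$ of the unit group, with generator $\xi$; $\mathcal{T}=\mathcal{T}^*\cup\{0\}$; $\mathcal{T}_S^*=\{1,\xi^2,\dots,\xi^{p^r-3}\}$ is the set of Teichmüller squares and $\mathcal{T}_N^*=\{\xi,\xi^3,\dots,\xi^{p^r-2}\}$ the set of Teichmüller non-squares. For a collection $D=\{D_1,\dots,D_b\}$ of subsets of an additive abelian group $G$, the development is $dev(D)=\{D_i+g : 1\le i\le b,\ g\in G\}$; when $D$ is a $(v,k,\lambda)$ difference family (each $D_i$ has size $k$, $|G|=v$, and each nonzero element of $G$ arises exactly $\lambda$ times as a difference of two distinct elements of the same $D_i$), $dev(D)$ is the block collection of a $2$-$(v,k,\lambda)$ design with point set $G$. Two designs are isomorphic if there is a bijection between their point sets mapping the blocks of one onto the blocks of the other. *)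

(* Defs.v *)
From HB Require Import structures.
From mathcomp Require Import all_boot all_order all_algebra.

Set Implicit Arguments.
Unset Strict Implicit.
Unset Printing Implicit Defensive.

Import GRing.Theory.
Local Open Scope ring_scope.

(** * Difference families and designs *)

Definition translate (G : finZmodType) (B : {set G}) (g : G) : {set G} :=
  [set x + g | x in B].

Definition dev (G : finZmodType) (D : {set {set G}}) : {set {set G}} :=
  [set translate B g | B in D, g in [set: G]].

(* The last condition counts triples (B, x, y) with B in D, x and y distinct
   elements of B, and x - y = d. *)
Definition difference_family (G : finZmodType) (v k lambda : nat)
    (D : {set {set G}}) : Prop :=
  [/\ #|G| = v,
      forall B, B \in D -> #|B| = k
    & forall d : G, d != 0 ->
        (\sum_(B in D)
           #|[set xy in setX B B | (xy.1 != xy.2) && (xy.1 - xy.2 == d)%R]|)%N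
        = lambda].

Definition disjoint_difference_family (G : finZmodType) (v k lambda : nat)
    (D : {set {set G}}) : Prop :=
  difference_family v k lambda D /\ trivIset D.

Definition design2 (P : finType) (v k lambda : nat)
    (Bs : {set {set P}}) : Prop :=
  [/\ #|P| = v,
      forall B, B \in Bs -> #|B| = k
    & forall x y : P, x != y ->
        #|[set B in Bs | (x \in B) && (y \in B)]| = lambda].

Definition designs_isomorphic (P Q : finType)
    (Bs : {set {set P}}) (Cs : {set {set Q}}) : Prop :=
  exists2 phi : P -> Q, bijective phi & [set phi @: B | B : {set P} in Bs] = Cs.

(** * The Galois ring GR(p^2, r) *)

Definition reduce_mod_p (p : nat) (a : 'Z_(p ^ 2)) : 'F_p := (a : nat)%:R.

Definition galois_poly (p r : nat) (f : {poly 'Z_(p ^ 2)}) : Prop :=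
  [/\ f \is monic, size f = r.+1
    & irreducible_poly (map_poly (@reduce_mod_p p) f)].

(* [{poly %/ f}] is the quotient by f only if f is monic of positive degree,
   which [galois_poly p r f] ensures for 0 < r. *)
Definition galois_ring (p : nat) (f : {poly 'Z_(p ^ 2)}) : Type :=
  {poly %/ f}.

HB.instance Definition _ (p : nat) (f : {poly 'Z_(p ^ 2)}) :=
  GRing.ComNzRing.on (galois_ring f).
HB.instance Definition _ (p : nat) (f : {poly 'Z_(p ^ 2)}) :=
  Finite.on (galois_ring f).

(** * The two families *)

Definition dilate (R : finNzRingType) (c : R) (A : {set R}) : {set R} :=
  [set c * t | t in A].

Section Teichmuller.

(* q stands for p ^ r and xi for an element of multiplicative order q - 1. *)
Variables (R : finComNzRingType) (q : nat) (xi : R).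

Definition teich : {set R} := 0 |: [set xi ^+ i | i : 'I_(q - 1)].

Definition teich_sq : {set R} := [set xi ^+ (2 * i) | i : 'I_((q - 1) %/ 2)].

Definition teich_nsq : {set R} :=
  [set xi ^+ (2 * i + 1) | i : 'I_((q - 1) %/ 2)].

Definition EH (p : nat) : {set {set R}} :=
  [set dilate (1 + p%:R * alpha) teich_sq | alpha in teich]
    :|: [set dilate p%:R teich_sq]
    :|: [set dilate (1 + p%:R * alpha) teich_nsq | alpha in teich]
    :|: [set dilate p%:R teich_nsq].

End Teichmuller.

Definition powers (F : finFieldType) (e : nat) : {set F} :=
  [set x ^+ e | x in [set x : F | x != 0]].

Definition CH (F : finFieldType) (q : nat) : {set {set F}} :=
  [set dilate a (powers F (2 * (q + 1))) | a in [set a : F | a != 0]].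

(* Main.v *)
Require Import Defs.
From HB Require Import structures.
From mathcomp Require Import all_boot all_order all_algebra.
From mathcomp Require Import all_fingroup all_solvable all_field.
From mathcomp Require Import zify ring.

(** Both families consist of the orbits of a group of units of a finite
    commutative ring R, acting by multiplication on the nonzero elements.  For
    C^H the ring is the field and the group H is the set of nonzero squares of
    its subfield of order q = p ^ r ([powersE]); for E^H it is the Galois ring
    and the group is the set T_S of Teichmuller squares ([EH_orbits]).  In both
    cases 1 - s is a unit for every s <> 1 in the group, hence every nonzero d
    is x * (1 - s) for exactly one x, and this says that the orbits form a
    disjoint difference family with lambda = |H| - 1
    ([orbits_difference_family]).  An orbit sums to 0 and |H| is prime to |R|,
    so a translate determines the orbit and the translation it comes from; the
    development is then a 2-design ([dev_orbits_design2]).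

    The designs are told apart by the numbers of points shared by two blocks,
    taken modulo 6.

    In dev(C^H) the number 2 modulo 6 does not occur
    ([dev_orbits_intersection_mod6]).  Every block lies on a line of the affine
    plane F over its subfield of order q, so that two blocks on different lines
    share at most one point.  Blocks on a common line are translated cosets of
    the squares; counting the solutions of u^2 - v^2 = d shows that they share
    (q - 5) / 4, (q - 1) / 4, (q - 1) / 2 or 0 points, and as q = 1 modulo 24
    these numbers are -1 or 0 modulo 6.

    In dev(E^H) the blocks T_S and T_S - 1 share 2 points modulo 6
    ([card_self_intersection]).  A common point is a y in T_S with y + 1 in T_S,
    that is, a projective solution of a + b + c = 0 with coordinates in T_S
    (note -1 is in T_S), and permuting the coordinates makes the symmetric group
    on three letters act on these points.  The involution y -> 1/y could only
    fix 1 or -1.  The point -1 is excluded because 0 is not in T_S, and 1 would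
    need 2 in T_S, hence 2 ^ (q - 1) = 1 in a ring of characteristic p ^ 2, which
    forces 2 ^ (p - 1) = 1 modulo p ^ 2.  The rotation y -> -(1 + y)/y of order
    three fixes exactly the two primitive cube roots of unity.  So the number of
    common points is even, and 2 modulo 3. *)

Set Implicit Arguments.
Unset Strict Implicit.
Unset Printing Implicit Defensive.

Import GRing.Theory.

(** * Developments of difference families *)

Section DevelopmentDesign.

Local Open Scope ring_scope.

Variable G : finZmodType.
Implicit Types (B : {set G}) (D : {set {set G}}).

Lemma mem_translate B g x : (x \in translate B g) = (x - g \in B).
Proof.
apply/imsetP/idP => [[y By ->]|Bx]; first by rewrite addrK.
by exists (x - g); rewrite // subrK.
Qed.

Lemma card_translate B g : #|translate B g| = #|B|.
Proof. by rewrite card_imset //; apply: addIr. Qed.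

Lemma devP D C :
  reflect (exists B g, B \in D /\ C = translate B g) (C \in dev D).
Proof.
apply: (iffP imset2P) => [[B g DB _ ->]|[B [g [DB ->]]]]; first by exists B, g.
by exists B g; rewrite ?inE.
Qed.

Lemma difference_pairs B d : d != 0 ->
  [set xy in setX B B | (xy.1 != xy.2) && (xy.1 - xy.2 == d)]
    = [set (x, x - d) | x in [set x in B | x - d \in B]].
Proof.
move=> d0; apply/setP=> -[x y]; rewrite !inE /=; apply/idP/imsetP.
  case/andP=> /andP[Bx By] /andP[_ /eqP <-].
  by exists x; rewrite ?inE subKr ?Bx.
case=> z; rewrite inE => /andP[Bz Bzd] [-> ->].
by rewrite Bz Bzd subKr eqxx !andbT -subr_eq0 subKr.
Qed.

Lemma card_difference_pairs B d : d != 0 ->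
  #|[set xy in setX B B | (xy.1 != xy.2) && (xy.1 - xy.2 == d)]|
    = #|[set x in B | x - d \in B]|.
Proof. by move=> d0; rewrite difference_pairs // card_imset // => x y []. Qed.

(** A block of the development through x and y is a translate B + g, and
    g -> (x - g, y - g) turns the admissible g into the pairs of B with
    difference x - y.  Since [dev D] is a set, different pairs (B, g) must give
    different blocks for the count to come out right. *)
Lemma dev_design2 v k lambda D :
    difference_family v k lambda D ->
    {in D &, forall B B' g g', translate B g = translate B' g' ->
       B = B' /\ g = g'} ->
  design2 v k lambda (dev D).
Proof.
case=> cardG cardD diffD injD; split=> // [C|x y neq_xy].
  by case/devP=> B [g [DB ->]]; rewrite card_translate; apply: cardD.
have d0 : x - y != 0 by rewrite subr_eq0.
rewrite -(diffD _ d0).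
pose S := [set u : {set G} * G | [&& u.1 \in D, x - u.2 \in u.1
                                  & y - u.2 \in u.1]].
have -> : [set C in dev D | (x \in C) && (y \in C)]
           = [set translate u.1 u.2 | u in S].
  apply/setP=> C; rewrite inE; apply/idP/imsetP.
    case/andP=> /devP[B [g [DB ->]]]; rewrite !mem_translate => /andP[Bx By].
    by exists (B, g); rewrite ?inE /= ?DB ?Bx.
  case=> -[B g]; rewrite inE /= => /and3P[DB Bx By] ->.
  rewrite !mem_translate Bx By !andbT; apply/devP; by exists B, g.
rewrite card_in_imset; last first.
  move=> [B g] [B' g']; rewrite !inE /= => /and3P[DB _ _] /and3P[DB' _ _] E.
  by case: (injD _ _ DB DB' _ _ E) => -> ->.
rewrite (eq_bigr (fun B => #|[set z in B | z - (x - y) \in B]|)); last first.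
  by move=> B _; rewrite card_difference_pairs.
rewrite -sum1_card (eq_bigl (fun u => (u.1 \in D) &&
   ((x - u.2 \in u.1) && (y - u.2 \in u.1)))); last by move=> u; rewrite inE.
(* Sum over the base block first: what is left for each B is a bijection. *)
rewrite -(pair_big_dep (fun B => B \in D)
  (fun B g => (x - g \in B) && (y - g \in B)) (fun _ _ => 1%N)) /=.
apply: eq_bigr => B _.
rewrite sum1dep_card.
have -> : [set z in B | z - (x - y) \in B]
  = [set x - g | g in [set g | (x - g \in B) && (y - g \in B)]].
  apply/setP=> z; rewrite inE; apply/idP/imsetP.
    case/andP=> Bz Bz'; exists (x - z); rewrite ?subKr // inE subKr Bz /=.
    by rewrite (_ : y - (x - z) = z - (x - y)) //; rewrite !opprB addrCA.
  case=> g; rewrite inE => /andP[Bx By] ->; rewrite Bx /=.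
  by rewrite (_ : x - g - (x - y) = y - g) // opprB addrC addrA subrK.
by rewrite card_imset // => g g' /addrI /oppr_inj.
Qed.

End DevelopmentDesign.

Lemma designs_isomorphic_card_setI (P Q : finType)
    (Bs : {set {set P}}) (Cs : {set {set Q}}) :
    designs_isomorphic Bs Cs ->
  {in Bs &, forall A B, exists A' B' : {set Q},
     [/\ A' \in Cs, B' \in Cs & #|A' :&: B'| = #|A :&: B|]}.
Proof.
case=> phi /bij_inj phi_inj <- A B BsA BsB.
exists (phi @: A), (phi @: B); split; try exact: imset_f.
rewrite -imsetI ?card_imset //.
by move=> x y _ _; apply: phi_inj.
Qed.

(** * Orbits of a fixed-point-free group of units *)

Lemma coprime_mulrn_eq0 (V : zmodType) (x : V) m n :
  coprime m n -> (x *+ m = 0 -> x *+ n = 0 -> x = 0)%R.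
Proof.
case: m => [|m] co_mn xm xn.
  by move: co_mn; rewrite /coprime gcd0n => /eqP n1; rewrite n1 in xn.
have [u v Euv _] := egcdnP n (ltn0Sn m).
have : (x *+ (u * m.+1) = 0)%R by rewrite mulnC mulrnA xm mul0rn.
by rewrite Euv (eqP co_mn) mulrnDr mulnC mulrnA xn mul0rn add0r.
Qed.

Section FixedPointFreeUnits.

Local Open Scope ring_scope.

(** The additive group of R with H acting by multiplication is a Ferrero pair.
    As R is finite, the last clause amounts to 1 - s being a unit for every
    s <> 1 in H. *)
Definition fpf_units (R : finComNzRingType) (H : {set R}) : Prop :=
  [/\ 1 \in H, {in H &, forall s t, s * t \in H},
      {in H, forall s, exists2 t, t \in H & s * t = 1}
    & {in H, forall s, s != 1 -> forall x, s * x = x -> x = 0}].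

Definition orbits (R : finComNzRingType) (H : {set R}) : {set {set R}} :=
  [set dilate a H | a in [set a | a != 0]].

Variables (R : finComNzRingType) (H : {set R}).
Hypothesis fpfH : fpf_units H.
Implicit Types a d x s t : R.

Lemma dilateP a x :
  reflect (exists2 s, s \in H & x = a * s) (x \in dilate a H).
Proof. exact: imsetP. Qed.

Lemma mem_dilate a s : s \in H -> a * s \in dilate a H.
Proof. by move=> Hs; apply: imset_f. Qed.

Lemma mem_dilate1 a : a \in dilate a H.
Proof. by case: fpfH => H1 _ _ _; rewrite -[X in X \in _]mulr1 mem_dilate. Qed.

Lemma fpf_mulrI a : a != 0 -> {in H &, injective ( *%R a)}.
Proof.
case: fpfH => _ HM HV fpf a0 s t Hs Ht Est.
have [t' Ht' tt'] := HV t Ht.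
have [/eqP st'|st'] := boolP (s * t' == 1).
  by rewrite -[s]mulr1 -tt' mulrCA st' mulr1.
case/eqP: a0; apply: (fpf (s * t')); rewrite ?HM //.
by rewrite mulrC mulrA Est -mulrA tt' mulr1.
Qed.

Lemma card_dilate a : a != 0 -> #|dilate a H| = #|H|.
Proof. by move=> a0; rewrite card_in_imset //; apply: fpf_mulrI. Qed.

Lemma dilate_mul a s : s \in H -> dilate (a * s) H = dilate a H.
Proof.
case: fpfH => _ HM HV _ Hs; apply/setP=> x; apply/imsetP/imsetP=> -[t Ht ->].
  by exists (s * t); rewrite ?HM ?mulrA.
have [s' Hs' ss'] := HV s Hs.
by exists (s' * t); rewrite ?HM // -mulrA (mulrA s) ss' mul1r.
Qed.

Lemma dilate_id s : s \in H -> dilate s H = H.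
Proof.
move=> Hs; rewrite -[s]mul1r dilate_mul //; apply/setP=> x.
by apply/imsetP/idP => [[t Ht ->]|Hx]; [rewrite mul1r | exists x; rewrite ?mul1r].
Qed.

Lemma dilate_mem a x : x \in dilate a H -> dilate x H = dilate a H.
Proof. by case/imsetP=> s Hs ->; apply: dilate_mul. Qed.

Lemma dilate_neq0 a x : a != 0 -> x \in dilate a H -> x != 0.
Proof.
case: fpfH => _ _ HV _ a0 /imsetP[s Hs ->]; have [t _ st] := HV s Hs.
by apply: contraNneq a0 => as0; rewrite -[a]mulr1 -st mulrA as0 mul0r.
Qed.

Lemma orbitsP B :
  reflect (exists2 a, a != 0 & B = dilate a H) (B \in orbits H).
Proof.
by apply: (iffP imsetP) => -[a a0 ->]; exists a; rewrite ?inE // in a0 *.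
Qed.

Lemma orbits_partition : partition (orbits H) [set x | x != 0].
Proof.
apply/and3P; split.
- apply/eqP/setP=> x; rewrite inE; apply/bigcupP/idP => [[B]|x0].
    by case/orbitsP=> a a0 ->; apply: dilate_neq0.
  by exists (dilate x H); [apply/orbitsP; exists x | apply: mem_dilate1].
- apply/trivIsetP=> _ _ /orbitsP[a a0 ->] /orbitsP[b b0 ->].
  apply: contraR => /pred0Pn[x /andP[/= ax bx]].
  by rewrite -(dilate_mem ax) -(dilate_mem bx).
- apply/orbitsP=> -[a a0 E].
  by have := mem_dilate1 a; rewrite -E inE.
Qed.

(** For s <> 1 the map x -> x * (1 - s) is injective, so it takes the value d
    exactly once. *)
Lemma card_fpf_difference d s : d != 0 -> s \in H ->
  #|[set x | (x != 0) && (x - d == x * s)]| = (s != 1).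
Proof.
case: fpfH => _ _ _ fpf d0 Hs; have [->|s1] /= := eqVneq s 1.
  apply: eq_card0 => x; rewrite inE mulr1 -[_ == x]subr_eq0 addrAC subrr add0r.
  by rewrite oppr_eq0 (negPf d0) andbF.
have inj_f : injective (fun x : R => x * (1 - s)).
  move=> x y /eqP; rewrite -subr_eq0 -mulrBl mulrBr mulr1 subr_eq0 => /eqP Exy.
  by apply/subr0_eq/(fpf s) => //; rewrite mulrC -Exy.
have [x xE] : exists x, x * (1 - s) = d.
  by have [g _ gK] := injF_bij inj_f; exists (g d); rewrite gK.
rewrite (_ : [set _ | _] = [set x]) ?cards1 //; apply/setP=> y; rewrite !inE.
rewrite -xE; apply/andP/eqP => [[_ /eqP E]|->].
  by apply: inj_f; rewrite mulrBr mulr1 -E subKr.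
split; last by rewrite mulrBr mulr1 subKr.
by apply: contraNneq d0 => x0; rewrite -xE x0 mul0r.
Qed.

(** The orbits partition the nonzero elements, so the pairs with difference d
    inside an orbit are the pairs (x, x * s) with s in H and x - x * s = d:
    there is one of them for each s <> 1. *)
Lemma orbits_difference_family :
  disjoint_difference_family #|R| #|H| (#|H| - 1) (orbits H).
Proof.
have [covD trivD _] := and3P orbits_partition.
split=> //; split=> // [_ /orbitsP[a a0 ->]|d d0]; first exact: card_dilate.
rewrite (eq_bigr (fun B : {set R} => \sum_(x in B) ((x - d)%R \in dilate x H))%N); last first.
  move=> _ /orbitsP[a a0 ->]; rewrite card_difference_pairs // -sum1_card.
  rewrite big_mkcond /= [RHS]big_mkcond /=; apply: eq_bigr => x _; rewrite inE.
  by case: (boolP (x \in _)) => //= ax; rewrite (dilate_mem ax); case: ifP.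
rewrite -(set_partition_big _ orbits_partition) /=.
rewrite (eq_bigr (fun x : R => \sum_(s in H) (x - d == x * s)%R)%N); last first.
  move=> x; rewrite inE => x0; have [/imsetP[s Hs Es]|xN] := boolP (_ \in _).
    rewrite (bigD1 s) //= Es eqxx big1 ?addn0 // => t /andP[Ht ts].
    apply/eqP; rewrite eqb0; apply: contraNneq ts => /(fpf_mulrI x0 Hs Ht) ->.
    by [].
  rewrite big1 // => s Hs; apply/eqP; rewrite eqb0.
  by apply: contraNneq xN => ->; apply: mem_dilate.
rewrite exchange_big /= (eq_bigr (fun s => (s != 1) : nat)); last first.
  move=> s Hs; rewrite -(card_fpf_difference d0 Hs) -sum1_card.
  rewrite big_mkcond /= [RHS]big_mkcond; apply: eq_bigr => x _.
  by rewrite !inE; case: ifP => //= _; case: ifP.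
have [H1 _ _ _] := fpfH.
rewrite (cardsD1 1 H) H1 add1n subn1 /= -sum1_card big_mkcond [RHS]big_mkcond /=.
by apply: eq_bigr => s _; rewrite !inE andbC; case: (s \in H); case: eqP.
Qed.

(** Multiplication by some s <> 1 of H permutes the orbit, so it fixes its sum;
    only 0 is fixed. *)
Lemma sum_dilate a : (1 < #|H|)%N -> \sum_(x in dilate a H) x = 0.
Proof.
case: fpfH => H1 HM HV fpf; have [->|a0] := eqVneq a 0.
  by move=> _; rewrite big1 // => _ /imsetP[s _ ->]; rewrite mul0r.
rewrite (cardsD1 1) H1 ltnS card_gt0 => /set0Pn[s].
rewrite !inE => /andP[s1 Hs]; apply: (fpf s) => //.
rewrite mulr_sumr -{2}(dilate_mul a Hs).
have -> : dilate (a * s) H = [set s * x | x in dilate a H].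
  by rewrite /dilate -imset_comp; apply: eq_imset => x /=; rewrite mulrCA mulrA.
rewrite [RHS]big_imset //= => x y _ _ E; have [t _ st] := HV s Hs.
by rewrite -[x]mul1r -[y]mul1r -st mulrAC E mulrAC.
Qed.

(** The elements of B + g add up to |H| * g, from which g can be recovered. *)
Lemma translate_orbits_inj : (1 < #|H|)%N -> coprime #|H| #|R| ->
  {in orbits H &, forall B B' g g', translate B g = translate B' g' ->
     B = B' /\ g = g'}.
Proof.
move=> H_gt1 coHR B B' DB DB' g g' E.
have sumB C h : C \in orbits H -> \sum_(x in translate C h) x = h *+ #|H|.
  case/orbitsP=> a a0 ->; rewrite big_imset /=; last by move=> x y _ _ /addIr.
  by rewrite big_split /= sum_dilate // add0r sumr_const card_dilate.
have gg' : g = g'.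
  have gH0 : (g - g') *+ #|H| = 0 by rewrite mulrnBl -(sumB B) // E sumB // subrr.
  have gR0 : (g - g') *+ #|R| = 0.
    by rewrite -FinRing.zmodXgE -cardsT expg_cardG ?inE.
  exact/subr0_eq/(coprime_mulrn_eq0 coHR).
split=> //; apply/setP=> x; move/setP/(_ (x + g)): E.
by rewrite !mem_translate -gg' addrK.
Qed.

Lemma dev_orbits_design2 : (1 < #|H|)%N -> coprime #|H| #|R| ->
  design2 #|R| #|H| (#|H| - 1) (dev (orbits H)).
Proof.
move=> H_gt1 coHR; apply: dev_design2; last exact: translate_orbits_inj.
by case: orbits_difference_family.
Qed.

End FixedPointFreeUnits.

(** * Solutions of a + b + c = 0 in a group of units *)

(** The orbits of a cyclic group of prime order l have length 1 or l.  The map f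
    need only behave well on X: it is extended by the identity to a permutation
    of T. *)
Lemma card_fix_mod (T : finType) (X : {set T}) (l : nat) (f : T -> T) :
    prime l -> {in X, forall x, f x \in X} ->
    {in X, forall x, iter l f x = x} ->
  #|X| = #|[set x in X | f x == x]| %[mod l].
Proof.
move=> l_prime fX fl.
pose h x := if x \in X then f x else x.
have hX x n : x \in X -> iter n h x = iter n f x /\ iter n f x \in X.
  move=> Xx; elim: n => [//|n [IH1 IH2]] /=.
  by rewrite IH1 /h IH2; split=> //; apply: fX.
have hN x n : x \notin X -> iter n h x = x.
  by move=> Xx; elim: n => [//|n /= ->]; rewrite /h (negPf Xx).
have hl x : iter l h x = x.
  case: (boolP (x \in X)) => Xx; last exact: hN.
  by case: (hX x l Xx) => -> _; exact: fl.
have h_inj : injective h.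
  apply: (can_inj (g := iter l.-1 h)) => x.
  by rewrite -iterSr prednK ?prime_gt0.
pose s := perm h_inj.
have sE n x : (s ^+ n)%g x = iter n h x.
  by rewrite permX; apply: eq_iter => y; rewrite permE.
have s_l : (s ^+ l)%g = 1%g by apply/permP=> x; rewrite sE hl perm1.
have l_group : (l.-group <[s]>)%g.
  rewrite /pgroup -orderE; apply: (@pnat_dvd _ l); last exact: pnat_id.
  by rewrite order_dvdn s_l.
have actsX : [acts <[s]>, on X | 'P]%g.
  rewrite cycle_subG !inE /=.
  apply/subsetP=> x Xx; rewrite inE /= apermE permE /h Xx; exact: (fX x Xx).
rewrite (pgroup_fix_mod l_group actsX); congr (_ %% _); apply: eq_card => x.
rewrite afix_cycle in_setI [RHS]inE; case: (boolP (x \in X)) => //= Xx.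
by apply/afix1P/eqP; rewrite /= apermE permE /h Xx.
Qed.

Section SelfIntersection.

Local Open Scope ring_scope.

Variables (R : finComNzRingType) (H : {set R}).
Hypothesis fpfH : fpf_units H.

Lemma fpf_units_neq0 s : s \in H -> s != 0.
Proof.
case: fpfH => _ _ HV _ /HV[t _ st].
by apply: contra_eq_neq st => ->; rewrite mul0r eq_sym oner_neq0.
Qed.

Lemma cube_root_eq0 w : w \in H -> w != 1 -> w ^+ 3 = 1 -> w ^+ 2 + w + 1 = 0.
Proof.
case: fpfH => _ _ _ fpf Hw w1 w3; apply: (fpf w) => //.
by rewrite !mulrDr -exprS w3 mulr1; ring.
Qed.

(** The factorization (x - w)(x - w^2) of x^2 + x + 1 determines the roots in H,
    where differences of distinct elements are not zero divisors. *)
Lemma cube_rootsE w : w \in H -> w != 1 -> w ^+ 3 = 1 ->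
  [set x in H | x ^+ 2 + x + 1 == 0] = [set w; w ^+ 2].
Proof.
move=> Hw w1 w3; have w2 := cube_root_eq0 Hw w1 w3.
case: fpfH => _ HM _ fpf; apply/setP=> x; rewrite !inE; apply/andP/orP.
  case=> Hx /eqP x2; have [->|xw] := eqVneq x w; [by left | right].
  rewrite -subr_eq0; apply/eqP/(fpf (x * w ^+ 2)); first by rewrite !HM.
    by apply: contraNneq xw => E; rewrite -[x]mulr1 -w3 exprSr mulrA E mul1r.
  have -> : x * w ^+ 2 * (x - w ^+ 2) = x ^+ 2 * w ^+ 2 - x * w ^+ 3 * w.
    by ring.
  rewrite w3; have -> : x ^+ 2 = - x - 1 by rewrite -[LHS]subr0 -x2; ring.
  have -> : w ^+ 2 = - w - 1 by rewrite -[LHS]subr0 -w2; ring.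
  by ring.
case=> /eqP->; first by rewrite Hw w2.
have -> : (w ^+ 2) ^+ 2 = w ^+ 3 * w by ring.
by rewrite w3 mul1r HM // [w + _]addrC w2.
Qed.

(** The points y with y and y + 1 in H are the projective solutions (y : 1 : c)
    of a + b + c = 0 in H, with c = - (y + 1).  Exchanging the first two
    coordinates is y -> 1 / y; rotating all three is y -> - (y + 1) / y.  The
    first has no fixed point as 2 is not in H, and the fixed points of the second
    are the roots of y^2 + y + 1. *)
Lemma card_self_intersection w : -1 \in H -> 1 + 1 \notin H ->
    w \in H -> w != 1 -> w ^+ 3 = 1 ->
  #|H :&: translate H (- 1)| = 2 %[mod 6].
Proof.
move=> HN1 HN2 Hw w1 w3; have [H1 HM HV fpf] := fpfH.
set X := H :&: _.
have XP x : (x \in X) = (x \in H) && (x + 1 \in H).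
  by rewrite inE mem_translate opprK.
pose inv x := odflt 0 [pick t in H | x * t == 1].
have invP x : x \in H -> inv x \in H /\ x * inv x = 1.
  move=> Hx; rewrite /inv; case: pickP => [t /andP[Ht /eqP]|] //.
  by have [t Ht xt] := HV x Hx => /(_ t); rewrite Ht xt eqxx.
have inv_uniq x y : x \in H -> x * y = 1 -> inv x = y.
  by move=> /invP[_ xx'] xy; rewrite -[LHS]mulr1 -xy mulrA (mulrC _ x) xx' mul1r.
have HN x : x \in H -> - x \in H by rewrite -mulN1r; apply: HM.
have X2 : #|X| = 0 %[mod 2].
  rewrite (card_fix_mod (f := inv)) //.
  - rewrite (_ : [set x in X | _] = set0) ?cards0 //.
    apply/setP=> x; rewrite !inE -in_setI -/X XP.
    apply/negP=> /andP[/andP[Hx Hx1] /eqP xx].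
    have [_] := invP x Hx; rewrite xx => x2.
    have [E|x1] := eqVneq x 1; first by rewrite E (negPf HN2) in Hx1.
    have := fpf_units_neq0 Hx1; rewrite (fpf x Hx x1 (x + 1)) ?eqxx //.
    by rewrite mulrDr x2; ring.
  - move=> x; rewrite !XP => /andP[Hx Hx1]; have [Hi xi] := invP x Hx.
    rewrite Hi /= (_ : inv x + 1 = inv x * (x + 1)) ?HM //.
    by rewrite mulrDr mulr1 mulrC xi addrC.
  - move=> x; rewrite XP => /andP[Hx _] /=; have [Hi xi] := invP x Hx.
    by apply: inv_uniq; rewrite // mulrC.
have X3 : #|X| = 2 %[mod 3].
  pose rho x := - (x + 1) * inv x.
  have rhoP x : x \in X -> rho x \in X /\ x * rho x = - (x + 1).
    rewrite XP => /andP[Hx Hx1]; have [Hi xi] := invP x Hx.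
    have E : x * rho x = - (x + 1) by rewrite mulrCA xi mulr1.
    split=> //; rewrite XP HM ?HN //=.
    suff -> : rho x + 1 = - inv x by apply: HN.
    by rewrite -{1}xi /rho; ring.
  rewrite (card_fix_mod (f := rho)) //.
  - rewrite (_ : [set x in X | _] = [set w; w ^+ 2]).
      rewrite cards2 (_ : w != w ^+ 2) //; apply: contraNneq w1 => E.
      by rewrite -w3 exprS -E -expr2 -E.
    rewrite -cube_rootsE //; apply/setP=> x; rewrite [LHS]inE [RHS]inE.
    apply/andP/andP => [[Xx /eqP xx]|[Hx /eqP x2]].
      have [_] := rhoP x Xx; rewrite xx => x2.
      by move: Xx; rewrite XP => /andP[-> _]; rewrite expr2 x2; split=> //;
        apply/eqP; ring.
    have [Hi xi] := invP x Hx.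
    have Ex : x + 1 = - x ^+ 2 by rewrite -[RHS]addr0 -x2; ring.
    rewrite XP Hx Ex HN ?HM //; split=> //.
    by rewrite /rho Ex opprK expr2 -mulrA xi mulr1.
  - by move=> x /rhoP[].
  (* With y, z, u the three iterates, x y = - (x + 1) and y z = - (y + 1) give
     x y z = 1, and then z u = - (z + 1) gives u = x. *)
  - move=> x Xx /=; have [Xy Ey] := rhoP x Xx; move: (rho x) Xy Ey => y Xy Ey.
    have [Xz Ez] := rhoP y Xy; move: (rho y) Xz Ez => z Xz Ez.
    have [_] := rhoP z Xz; move: (rho z) => u Eu.
    have xyz : x * y * z = 1.
      by rewrite -mulrA Ez mulrN mulrDr Ey; ring.
    have : x * y * (z * u) = x * y * - (z + 1) by rewrite Eu.
    rewrite mulrA xyz mul1r mulrN mulrDr xyz => ->.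
    by rewrite mulr1 Ey; ring.
by lia.
Qed.

End SelfIntersection.

(** * Block intersections in the finite field *)

(** The arithmetic of two blocks on a line: k is the number of nonzero squares,
    and n and m count, for the same d, the points that the squares share with
    their own translate by d and with that of the non-squares; b records whether
    d is a square. *)
Lemma line_count_mod6 q k n (b : bool) :
  q = 1 %[mod 24] -> q - 1 = 2 * k -> 4 * n + 4 * b = q - 1 ->
  (k %% 6 = 0) /\ (n %% 6 != 2) /\ (forall m, m + n + b = k -> m %% 6 = 0).
Proof. by case: b => /= q24 k2 n4; (split; [lia | split=> [|m]; lia]). Qed.

Section FiniteField.

Local Open Scope ring_scope.

Variable F : finFieldType.

Lemma finField_prim_root : {z : F | (#|F| - 1).-primitive_root z}.
Proof.
pose rs := enum (predC1 (0 : F)).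
have F_gt1 : (1 < #|F|)%N by apply: finNzRing_gt1.
have szrs : size rs = (#|F| - 1)%N by rewrite -cardE cardC1 subn1.
have /sig2W[z _ ?] : exists2 z, z \in rs & (#|F| - 1).-primitive_root z.
  apply/hasP; apply: has_prim_root; rewrite ?subn_gt0 ?szrs //; last first.
    exact: enum_uniq.
  apply/allP=> x; rewrite mem_enum => x0.
  rewrite unity_rootE; apply/eqP/(mulIf x0).
  by rewrite -exprSr subn1 prednK ?(ltnW F_gt1) // expf_card mul1r.
by exists z.
Qed.

Lemma card_unity_roots n : (n %| #|F| - 1)%N -> #|[set x : F | x ^+ n == 1]| = n.
Proof.
have [z pz] := finField_prim_root => n_dv; have pw := dvdn_prim_root pz n_dv.
set w := z ^+ _ in pw.
rewrite (_ : [set _ | _] = [set w ^+ i | i : 'I_n]).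
  rewrite card_imset ?card_ord // => i j /eqP.
  by rewrite (eq_prim_root_expr pw) !modn_small // => /eqP/val_inj.
apply/setP=> x; rewrite inE; apply/eqP/imsetP => [/(prim_rootP pw)[i ->]|[i _ ->]].
  by exists i.
by rewrite -exprM mulnC exprM (prim_expr_order pw) expr1n.
Qed.

(** In a cyclic group of order e * n the elements killed by n are the e-th
    powers. *)
Lemma unity_root_power e n x : (e * n)%N = (#|F| - 1)%N -> x ^+ n = 1 ->
  exists2 y : F, y != 0 & x = y ^+ e.
Proof.
have [z pz] := finField_prim_root => en; have n_dv : (n %| #|F| - 1)%N.
  by rewrite -en dvdn_mull.
have n_gt0 : (0 < n)%N by apply: dvdn_gt0 n_dv; apply: prim_order_gt0 pz.
case/(prim_rootP (dvdn_prim_root pz n_dv)) => i ->; rewrite -en mulnK //.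
exists (z ^+ i); last by rewrite exprAC.
rewrite expf_neq0 // -unitfE -(unitrX_pos _ (prim_order_gt0 pz)).
by rewrite (prim_expr_order pz) unitr1.
Qed.

Lemma powersE e n : (e * n)%N = (#|F| - 1)%N ->
  powers F e = [set x | x ^+ n == 1].
Proof.
move=> en; apply/setP=> x; rewrite inE; apply/imsetP/eqP => [[y]|].
  rewrite inE => y0 ->; rewrite -exprM en; apply: (mulIf y0).
  by rewrite -exprSr subn1 prednK ?expf_card ?mul1r // (ltnW (finNzRing_gt1 F)).
by case/(unity_root_power en) => y y0 ->; exists y; rewrite ?inE.
Qed.

Lemma fpf_units_unity_roots n : (0 < n)%N ->
  fpf_units [set x : F | x ^+ n == 1].
Proof.
move=> n_gt0; split=> [|s t|s|s]; rewrite ?inE ?expr1n //.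
- by rewrite exprMn => /eqP-> /eqP->; rewrite mulr1.
- move=> sn; exists (s ^+ n.-1); last by rewrite -exprS prednK ?(eqP sn).
  by rewrite inE exprAC (eqP sn) expr1n.
- move=> _ s1 x /eqP; rewrite -subr_eq0 -[X in _ - X]mul1r -mulrBl mulf_eq0.
  by rewrite subr_eq0 (negPf s1) => /eqP.
Qed.

Section QuadraticExtension.

Variables q k : nat.
Hypotheses (k2 : (q - 1 = 2 * k)%N) (cardF : #|F| = (q ^ 2)%N)
  (q_pchar : [pchar F].-nat q)
  (q_mod24 : (q = 1 %[mod 24])%N) (q_gt1 : (1 < q)%N).

(** [Fq] is the subfield of order q, and [Sq] the group of its nonzero squares,
    given by Euler's criterion. *)
Let Sq : {set F} := [set x | x ^+ k == 1].
Let Fq : {set F} := [set x | x ^+ q == x].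

Let k_gt0 : (0 < k)%N.
Proof. by lia. Qed.

Let q1_dvd : (q - 1 %| #|F| - 1)%N.
Proof. by rewrite cardF; apply/dvdnP; exists (q + 1)%N; nia. Qed.

Let two_neq0 : (1 + 1 : F) != 0.
Proof.
apply/eqP=> two0; have : (2 \in [pchar F])%N by rewrite inE /= mulr2n two0.
move/pcharf_eq=> /eq_pnat E; have := q_pchar; rewrite E => /p_natP[m qE].
by case: m qE => [|m] qE; [lia | move: qE; rewrite expnS; lia].
Qed.

Lemma sqr_expf_half (x : F) : (x ^+ 2) ^+ k = x ^+ (q - 1).
Proof. by rewrite -exprM -k2. Qed.

Lemma mem_subfield x : (x \in Fq) = (x == 0) || (x ^+ (q - 1) == 1).
Proof.
rewrite inE; have [->|x0] /= := eqVneq x 0.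
  by rewrite expr0n; case: q q_gt1 => //= n _; rewrite eqxx.
rewrite -{1}(subnK (ltnW q_gt1)) addn1 exprSr.
by rewrite -[X in _ == X]mul1r (inj_eq (mulIf x0)).
Qed.

Lemma subfield_add x y : x \in Fq -> y \in Fq -> x + y \in Fq.
Proof. by rewrite !inE exprDn_pchar // => /eqP-> /eqP->. Qed.

Lemma subfield_mul x y : x \in Fq -> y \in Fq -> x * y \in Fq.
Proof. by rewrite !inE exprMn => /eqP-> /eqP->. Qed.

Lemma subfield_inv x : x \in Fq -> x^-1 \in Fq.
Proof. by rewrite !inE exprVn => /eqP->. Qed.

Lemma subfield_1 : 1 \in Fq.
Proof. by rewrite inE expr1n. Qed.

Lemma subfield_opp x : x \in Fq -> - x \in Fq.
Proof.
move=> Kx; rewrite -mulN1r subfield_mul // mem_subfield; apply/orP; right.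
by rewrite k2 exprM sqrrN !expr1n.
Qed.

Lemma subfield_sub x y : x \in Fq -> y \in Fq -> x - y \in Fq.
Proof. by move=> Kx Ky; rewrite subfield_add ?subfield_opp. Qed.

Lemma squares_subfield x : x \in Sq -> x \in Fq.
Proof.
rewrite mem_subfield inE => /eqP xk.
by rewrite [X in x ^+ X == 1]k2 mulnC exprM xk expr1n eqxx orbT.
Qed.

Lemma squares_neq0 x : x \in Sq -> x != 0.
Proof.
rewrite inE; apply: contraTneq => ->.
by rewrite expr0n (gtn_eqF k_gt0) /= eq_sym oner_eq0.
Qed.

Lemma sqr_in_squares x : x \in Fq -> x != 0 -> x ^+ 2 \in Sq.
Proof. by rewrite mem_subfield => /orP[->//|x1] _; rewrite inE sqr_expf_half. Qed.

(** A k-th root of unity is z ^ (2 * (q + 1)) for some z of F, and z ^ (q + 1),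
    the norm of z, lies in the subfield. *)
Lemma squares_sqrt x : x \in Sq -> exists y, [/\ y \in Fq, y != 0 & x = y ^+ 2].
Proof.
have E2 : (2 * (q + 1) * k)%N = (#|F| - 1)%N by rewrite cardF; nia.
rewrite inE => /eqP/(unity_root_power E2)[z z0 ->]; exists (z ^+ (q + 1)).
rewrite expf_neq0 // -exprM mulnC; split=> //; rewrite mem_subfield; apply/orP; right.
rewrite -exprM (_ : ((q + 1) * (q - 1) = #|F| - 1)%N); last by rewrite cardF; nia.
apply/eqP/(mulIf z0); rewrite -exprSr subn1 prednK ?expf_card ?mul1r //.
by rewrite cardF; nia.
Qed.

(** q = 1 modulo 4, so -1 is a square. *)
Lemma squares_opp x : (- x \in Sq) = (x \in Sq).
Proof.
rewrite !inE exprNn (_ : k = 2 * (k %/ 2))%N; last by lia.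
by rewrite [(-1) ^+ _]exprM sqrrN !expr1n mul1r.
Qed.

Lemma card_squares : #|Sq| = k.
Proof.
apply: card_unity_roots; apply: dvdn_trans q1_dvd.
by rewrite [X in (_ %| X)%N]k2 dvdn_mull.
Qed.

(** a^4 = d^2 means a^2 = d or a^2 = -d.  Both d and -d are squares or both are
    not; if d = b^2, the solutions are b times a fourth root of unity. *)
Lemma card_fourth_powers_eq d : d \in Fq -> d != 0 ->
  #|[set a in Fq | (a != 0) && (a ^+ 4 == d ^+ 2)]| = (4 * (d \in Sq))%N.
Proof.
move=> Kd d0; have [Hd|Hd] := boolP (d \in Sq).
  have [b [Kb b0 ->]] := squares_sqrt Hd; rewrite muln1.
  have dv4 : (4 %| q - 1)%N by lia.
  rewrite -[RHS](card_unity_roots (dvdn_trans dv4 q1_dvd)).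
  rewrite -[RHS](card_imset _ (mulfI b0)); apply: eq_card => a; rewrite !inE.
  apply/andP/imsetP => [[Ka /andP[a0 /eqP a4]]|[u]].
    exists (a / b); last by rewrite mulrC mulfVK.
    by rewrite inE expr_div_n a4 -exprM divff // expf_neq0.
  rewrite inE => /eqP u4 ->; rewrite [_ ^+ 4]exprMn u4 mulr1 -exprM eqxx andbT.
  have u0 : u != 0 by apply: contra_eq_neq u4 => ->; rewrite expr0n /= eq_sym oner_eq0.
  rewrite mulf_neq0 //; split=> //.
  have : b * u \in Fq.
    by rewrite subfield_mul // mem_subfield -(divnK dv4) mulnC exprM u4 expr1n
      eqxx orbT.
  by rewrite inE.
apply: eq_card0 => a; rewrite !inE; apply/negP => /andP[Ka /andP[a0]].
rewrite (_ : 4 = 2 * 2)%N // exprM eqf_sqr => a2.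
have := sqr_in_squares (_ : a \in Fq) a0; rewrite inE Ka => /(_ isT).
by case/orP: a2 => /eqP->; rewrite ?squares_opp (negPf Hd).
Qed.

(** The parameters a counted here are those for which neither coordinate of the
    point (a + d/a, a - d/a) of a hyperbola vanishes, as
    (a + d/a)(a - d/a) = (a^4 - d^2) / a^2. *)
Lemma card_nondegenerate_parameters d : d \in Fq -> d != 0 ->
  (#|[set a in Fq | (a != 0%R) && (a ^+ 4 != d ^+ 2)%R]| + 4 * (d \in Sq)
    = q - 1)%N.
Proof.
move=> Kd d0; rewrite -card_fourth_powers_eq // -[RHS](card_unity_roots q1_dvd).
rewrite -[RHS](cardsID [set a | a ^+ 4 == d ^+ 2]) addnC.
have subfield_unit (a : F) : (a ^+ q == a) && (a != 0) = (a ^+ (q - 1) == 1).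
  have := mem_subfield a; rewrite inE => ->; have [->|] //= := eqVneq a 0.
    by rewrite expr0n subn_eq0 leqNgt q_gt1 eq_sym oner_eq0.
  by rewrite andbT.
by congr addn; apply: eq_card => a; rewrite !inE -subfield_unit andbA // andbC.
Qed.

(** A point x shared by the squares and their translate by d is u^2 with
    x - d = v^2.  The hyperbola u^2 - v^2 = d is parametrized by a = u + v, with
    u = (a + d/a) / 2 and v = (a - d/a) / 2, and neither u nor v may vanish.  The
    four choices of signs of u and v make the map a -> u^2 four to one. *)
Lemma card_squares_shift d : d \in Fq -> d != 0 ->
  (4 * #|Sq :&: translate Sq d| + 4 * (d \in Sq) = q - 1)%N.
Proof.
move=> Kd d0; rewrite -(card_nondegenerate_parameters Kd d0); congr addn.
set Y := [set a in Fq | _]; set Z := Sq :&: _.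
pose t : F := 1 + 1; have Kt : t \in Fq by rewrite subfield_add ?subfield_1.
pose f a : F := ((a + d / a) / t) ^+ 2.
have fd a : a != 0 -> f a - d = ((a - d / a) / t) ^+ 2.
  by move=> a0; rewrite /f /t; field; rewrite two_neq0.
have fY : {in Y, forall a, f a \in Z}.
  move=> a; rewrite inE => /and3P[Ka a0 a4].
  have Kda : d / a \in Fq by rewrite subfield_mul ?subfield_inv.
  have a4E : a ^+ 4 - d ^+ 2 = a ^+ 2 * (a - d / a) * (a + d / a) by field.
  have := a4; rewrite -subr_eq0 a4E !mulf_eq0 !negb_or => /andP[/andP[_ am] ap].
  rewrite inE mem_translate fd //.
  by rewrite !sqr_in_squares ?subfield_mul ?subfield_inv ?subfield_add
    ?subfield_opp ?subfield_1 ?mulf_neq0 ?invr_neq0.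
rewrite -[RHS]sum1_card (partition_big f (mem Z)) //=.
rewrite mulnC -sum_nat_const; apply: eq_bigr => x.
rewrite inE mem_translate => /andP[Hx Hxd].
have [u [Ku u0 xE]] := squares_sqrt Hx; have [v [Kv v0 xdE]] := squares_sqrt Hxd.
have dE : d = (u + v) * (u - v) by rewrite -[LHS](subKr x) xdE xE; ring.
have [a0 b0] : u + v != 0 /\ u - v != 0.
  by apply/andP; rewrite -negb_or -mulf_eq0 -dE.
have fE b : b != 0 -> (f b == x) =
    [|| b == u + v, b == - (u + v), b == u - v | b == - (u - v)].
  move=> b_0.
  have E : f b - x =
     (b - (u + v)) * (b + (u + v)) * (b - (u - v)) * (b + (u - v))
       / (t * b) ^+ 2.
    by rewrite /f /t xE dE; field; rewrite b_0 two_neq0.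
  rewrite -[LHS]subr_eq0 E mulf_eq0 invr_eq0 expf_eq0 (mulf_eq0 t b) (negPf b_0).
  rewrite (negPf two_neq0) andbF orbF !mulf_eq0 !subr_eq0 !addr_eq0 -!orbA.
  by [].
have neqN (y : F) : y != 0 -> y != - y.
  by move=> y0; rewrite -addr_eq0 (_ : y + y = t * y) ?mulf_neq0 // /t; ring.
pose s := [:: u + v; - (u + v); u - v; - (u - v)].
have uniq_s : uniq s.
  have uv : u + v != u - v.
    by rewrite (inj_eq (addrI u)) neqN.
  have uNv : u + v != - (u - v).
    by rewrite opprB addrC (inj_eq (addrI v)) neqN.
  by rewrite /= !inE !negb_or eqr_opp eqr_oppLR uv uNv !neqN.
rewrite (eq_bigl (mem s)) ?sum1_card ?(card_uniqP uniq_s) // => b.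
rewrite [RHS]inE; apply/andP/idP => [[]|bE].
  rewrite inE => /and3P[_ b_0 _]; rewrite fE // => bE.
  by rewrite !inE.
have Kb : b \in Fq.
  by move: bE; rewrite !in_cons in_nil orbF => /or4P[]/eqP->;
    rewrite ?subfield_opp ?subfield_add ?subfield_opp.
have b_0 : b != 0.
  by move: bE; rewrite !in_cons in_nil orbF => /or4P[]/eqP->; rewrite ?oppr_eq0.
split; last by rewrite fE //; move: bE; rewrite !in_cons in_nil orbF.
rewrite inE Kb b_0 -subr_eq0 /=.
have n0 : t * t * u * v != 0 by rewrite !mulf_neq0.
move: bE; rewrite !in_cons in_nil orbF => /or4P[]/eqP->.
- have -> : (u + v) ^+ 4 - d ^+ 2 = (u + v) ^+ 2 * (t * t * u * v).
    by rewrite dE /t; ring.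
  by rewrite mulf_neq0 ?expf_neq0.
- have -> : (- (u + v)) ^+ 4 - d ^+ 2 = (u + v) ^+ 2 * (t * t * u * v).
    by rewrite dE /t; ring.
  by rewrite mulf_neq0 ?expf_neq0.
- have -> : (u - v) ^+ 4 - d ^+ 2 = - (u - v) ^+ 2 * (t * t * u * v).
    by rewrite dE /t; ring.
  by rewrite mulf_neq0 ?oppr_eq0 ?expf_neq0.
- have -> : (- (u - v)) ^+ 4 - d ^+ 2 = - (u - v) ^+ 2 * (t * t * u * v).
    by rewrite dE /t; ring.
  by rewrite mulf_neq0 ?oppr_eq0 ?expf_neq0.
Qed.

Let fpf_squares : fpf_units Sq.
Proof. exact: fpf_units_unity_roots. Qed.

(** The non-squares of the subfield form a single coset, on which the k-th power
    is -1. *)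
Lemma mem_nonsquare_coset c y : c \in Fq -> c != 0 -> c \notin Sq ->
  y \in Fq -> y != 0 -> (y \in dilate c Sq) = (y \notin Sq).
Proof.
move=> Kc c0 cH Ky y0.
have sgn z : z \in Fq -> z != 0 -> z \notin Sq -> z ^+ k = - 1.
  rewrite mem_subfield => /orP[/eqP->|]; first by rewrite eqxx.
  rewrite k2 mulnC exprM sqrf_eq1 inE => /orP[/eqP->|/eqP->//].
  by rewrite eqxx.
apply/dilateP/idP => [[s Hs ->]|yH].
  apply: contra cH; rewrite !inE exprMn; move: Hs; rewrite inE => /eqP->.
  by rewrite mulr1.
exists (y / c); last by rewrite mulrC mulfVK.
by rewrite inE expr_div_n !sgn // divff // oppr_eq0 oner_eq0.
Qed.

(** For a square x, the element x - d of the subfield is a non-square, a nonzero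
    square or 0. *)
Lemma card_nonsquare_intersection c d : c \in Fq -> c != 0 -> c \notin Sq ->
    d \in Fq ->
  (#|Sq :&: translate (dilate c Sq) d| + #|Sq :&: translate Sq d| + (d \in Sq)
    = k)%N.
Proof.
move=> Kc c0 cH Kd.
have E1 : #|(Sq :\: translate Sq d) :&: [set d]| = (d \in Sq).
  rewrite (_ : _ :&: [set d] = if d \in Sq then [set d] else set0).
    by case: ifP; rewrite ?cards1 ?cards0.
  apply/setP=> x; rewrite in_setI in_setD mem_translate in_set1.
  have [->|xd] := eqVneq x d.
    rewrite subrr andbT (negPf (_ : 0 \notin Sq)) /=.
      by case: (d \in Sq); rewrite ?in_set1 ?inE ?eqxx.
    by apply/negP => /squares_neq0; rewrite eqxx.
  by rewrite andbF; case: ifP => _; rewrite ?in_set1 ?(negPf xd) // inE.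
have E2 : #|(Sq :\: translate Sq d) :\: [set d]|
            = #|Sq :&: translate (dilate c Sq) d|.
  apply: eq_card => x.
  rewrite in_setI !in_setD !mem_translate in_set1.
  have [Hx|] := boolP (x \in Sq); last by rewrite !andbF.
  rewrite andbT /=; have [->|xd] /= := eqVneq x d.
    rewrite subrr; apply/esym/negbTE/negP => /(dilate_neq0 fpf_squares c0).
    by rewrite eqxx.
  by rewrite mem_nonsquare_coset ?subfield_sub
    ?(squares_subfield Hx) ?subr_eq0 ?andbT.
rewrite -card_squares -(cardsID (translate Sq d) Sq).
by rewrite -(cardsID [set d] (Sq :\: _)) E1 E2 [RHS]addnCA [RHS]addnC;
  congr addn; apply: addnC.
Qed.

(** Two common points force c and d into the subfield, since c is then a quotient
    of differences of squares.  What remains is the count on one line. *)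
Lemma coset_intersection_mod6 c d : c != 0 ->
  (#|Sq :&: translate (dilate c Sq) d| %% 6 != 2)%N.
Proof.
move=> c0; set n := #|_|.
have [n_le1|] := leqP n 1; first by move: n_le1; case: n => [|[]].
case/card_gt1P=> x [y []]; rewrite !in_setI !mem_translate.
move=> /andP[Hx /dilateP[s Hs xE]] /andP[Hy /dilateP[t Ht yE]] xy.
have xyE : x - y = c * (s - t) by rewrite mulrBr -xE -yE; ring.
have st : s - t != 0.
  by apply: contraNneq xy => st0; rewrite -subr_eq0 xyE st0 mulr0.
have Kc : c \in Fq.
  by rewrite -(mulfK st c) -xyE subfield_mul ?subfield_inv ?subfield_sub
    ?squares_subfield.
have Kd : d \in Fq.
  by rewrite -[d](subKr x) xE subfield_sub ?subfield_mul
    ?(squares_subfield Hx) ?(squares_subfield Hs).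
have card_shift0 : #|Sq :&: translate Sq 0| = k.
  rewrite -[RHS]card_squares; apply: eq_card => z.
  by rewrite in_setI mem_translate subr0 andbb.
have [Hc|Hc] := boolP (c \in Sq); rewrite /n.
  rewrite (dilate_id fpf_squares Hc); have [->|d0] := eqVneq d 0.
    rewrite card_shift0; have := card_squares_shift subfield_1 (oner_neq0 F).
    by case/(line_count_mod6 q_mod24 k2) => ->.
  by have := card_squares_shift Kd d0; case/(line_count_mod6 q_mod24 k2) => _ [].
have := card_nonsquare_intersection Kc c0 Hc Kd.
have [->|d0] := eqVneq d 0.
  rewrite card_shift0 addnAC -[RHS]add0n => /addIn/eqP.
  by rewrite addn_eq0 => /andP[/eqP->].
have := card_squares_shift Kd d0.
by case/(line_count_mod6 q_mod24 k2) => _ [_ nm] /nm ->.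
Qed.

(** The affine map x -> a * x + g takes the first block back to the squares. *)
Lemma dev_orbits_intersection_mod6 B C :
  B \in dev (orbits Sq) -> C \in dev (orbits Sq) -> (#|B :&: C| %% 6 != 2)%N.
Proof.
case/devP=> _ [g [/orbitsP[a a0 ->] ->]] /devP[_ [h [/orbitsP[b b0 ->] ->]]].
have c0 : b / a != 0 by rewrite mulf_neq0 ?invr_neq0.
have := coset_intersection_mod6 ((h - g) / a) c0; set X := _ :&: _.
rewrite -(card_imset (mem X) (inj_comp (addIr g) (mulfI a0))).
congr (_ %% 6 != 2)%N; apply: eq_card => x; rewrite in_setI !mem_translate.
apply/imsetP/andP => [[y]|[/dilateP[s Hs sE] /dilateP[t Ht tE]]].
  rewrite in_setI mem_translate => /andP[Hy /dilateP[t Ht tE]] -> /=.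
  rewrite addrK mem_dilate //; split=> //; apply/dilateP; exists t => //.
  have -> : b * t = a * (b / a * t) by field.
  by rewrite -tE; field.
exists s; last by rewrite /= -sE subrK.
rewrite in_setI mem_translate Hs /=; apply/dilateP; exists t => //.
apply: (mulfI a0); have -> : a * (b / a * t) = b * t by field.
by rewrite -tE mulrBr -sE; field.
Qed.

End QuadraticExtension.

End FiniteField.

(** * Teichmuller squares in a local ring with maximal ideal (p) *)

Section LocalRing.

Local Open Scope ring_scope.

Variables (R : finComNzRingType) (p q : nat).
Hypotheses (p_prime : prime p) (q_gt1 : (1 < q)%N) (p_dvd_q : (p %| q)%N).
Hypotheses (p2_eq0 : p%:R * p%:R = 0 :> R) (p_neq0 : p%:R != 0 :> R).
Hypothesis localR : forall x : R,
  (exists y, x = p%:R * y) \/ (exists y, x * y = 1).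
Hypothesis cardR : #|R| = (q ^ 2)%N.

Let coprime_q1 : coprime (q - 1) p.
Proof.
rewrite coprime_sym prime_coprime //; apply/negP => dv.
have : (p %| q - (q - 1))%N by rewrite dvdn_sub.
by rewrite subKn ?(ltnW q_gt1) // dvdn1; case: eqP p_prime => [->|].
Qed.

(** Since p^2 = 0, the n-th power of 1 + p z is 1 + n p z, while p z is killed
    by p: the group 1 + (p) has exponent p. *)
Lemma principal_unit_torsion n (z : R) : coprime n p ->
  (1 + p%:R * z) ^+ n = 1 -> 1 + p%:R * z = 1.
Proof.
have E m : (1 + p%:R * z) ^+ m = 1 + p%:R * z *+ m.
  elim: m => [|m IH]; first by rewrite addr0.
  rewrite exprS IH mulrSr; set a := p%:R * z.
  have aa : a * a = 0 by rewrite /a mulrACA p2_eq0 mul0r.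
  by rewrite mulrDl !mul1r mulrDr mulr1 mulrnAr aa mul0rn addr0 addrA.
rewrite E => co /eqP; rewrite -subr_eq0 addrC addKr => /eqP zn.
rewrite (coprime_mulrn_eq0 co zn) ?addr0 //.
by rewrite -[LHS]mulr_natl mulrA p2_eq0 mul0r.
Qed.

(** Otherwise 1 - s would lie in the maximal ideal, and s would be a principal
    unit of order prime to p. *)
Lemma unity_root_sub1_unit (s : R) : s ^+ (q - 1) = 1 -> s != 1 ->
  exists y, (1 - s) * y = 1.
Proof.
move=> sq s1; case: (localR (1 - s)) => // -[y sE].
have sE' : s = 1 + p%:R * - y by rewrite mulrN -sE; ring.
case/eqP: s1; rewrite sE'; apply: (principal_unit_torsion coprime_q1).
by rewrite -sE'.
Qed.

Lemma unity_root_fpf (s x : R) : s ^+ (q - 1) = 1 -> s != 1 -> s * x = x -> x = 0.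
Proof.
move=> sq s1 sx; have [y sy] := unity_root_sub1_unit sq s1.
by rewrite -[x]mulr1 -sy mulrA mulrBr mulr1 [x * s]mulrC sx subrr mul0r.
Qed.

Let pR : {set R} := [set p%:R * x | x : R].

Lemma unit_notin_pR (x y : R) : x * y = 1 -> x \notin pR.
Proof.
move=> xy; apply/negP => /imsetP[z _ xE]; case/eqP: p_neq0.
have : p%:R * (x * y) = 0 by rewrite xE !mulrA p2_eq0 !mul0r.
by rewrite xy mulr1.
Qed.

(** So (p) is both the image and the kernel of multiplication by p; this gives
    its order in [card_pR]. *)
Lemma annihilator_p (x : R) : (p%:R * x == 0) = (x \in pR).
Proof.
apply/eqP/imsetP => [px|[y _ ->]]; last by rewrite mulrA p2_eq0 mul0r.
case: (localR x) => [[y ->]|[y xy]]; first by exists y.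
have : p%:R * (x * y) = 0 by rewrite mulrA px mul0r.
by rewrite xy mulr1 => p0; case/eqP: p_neq0.
Qed.

Lemma card_pR : #|pR| = q.
Proof.
suff E : #|R| = (#|pR| * #|pR|)%N.
  by apply/eqP; rewrite -(eqn_exp2r _ _ (isT : 0 < 2)%N) -cardR E expnS expn1.
rewrite -[LHS]sum1_card.
rewrite (partition_big (fun x : R => p%:R * x) (mem pR)) /=; last first.
  by move=> x _; apply: imset_f.
rewrite -sum_nat_const; apply: eq_bigr => _ /imsetP[x _ ->].
rewrite sum1dep_card -[RHS](card_imset _ (addrI x)); apply: eq_card => y.
rewrite inE; apply/eqP/imsetP => [E|[z]].
  exists (y - x); last by rewrite addrC subrK.
  by rewrite -annihilator_p mulrBr E subrr.
by rewrite -annihilator_p => /eqP pz ->; rewrite mulrDr pz addr0.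
Qed.

Variable xi : R.
Hypothesis xi_prim : (q - 1).-primitive_root xi.

Let xi_order n : (xi ^+ n) ^+ (q - 1) = 1.
Proof. by rewrite exprAC (prim_expr_order xi_prim) expr1n. Qed.

Let q1_gt0 : (0 < q - 1)%N. Proof. by rewrite subn_gt0. Qed.

Lemma xi_unit n : exists y, xi ^+ n * y = 1.
Proof. by exists ((xi ^+ n) ^+ (q - 1).-1); rewrite -exprS prednK. Qed.

Lemma teichP (x : R) :
  reflect (x = 0 \/ exists n, x = xi ^+ n) (x \in teich q xi).
Proof.
apply: (iffP setU1P) => -[]; [by left| |by left|].
  by case/imsetP=> i _ ->; right; exists i.
case=> n ->; right; apply/imsetP.
by exists (Ordinal (ltn_pmod n q1_gt0)); rewrite //= (prim_expr_mod xi_prim).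
Qed.

Lemma card_teich : #|teich q xi| = q.
Proof.
rewrite cardsU1 card_imset ?card_ord; last first.
  move=> i j /eqP; rewrite (eq_prim_root_expr xi_prim) !modn_small //.
  by move/eqP/val_inj.
rewrite (_ : 0 \notin _) ?add1n ?subn1 ?prednK ?(ltnW q_gt1) //.
apply/imsetP=> -[i _ E]; have [y] := xi_unit i; rewrite -E mul0r => /eqP.
by rewrite eq_sym oner_eq0.
Qed.

(** The quotient of two units s and t of the Teichmuller set is a root of unity
    of order prime to p, so that s - t is 0 or a unit. *)
Lemma teich_inj_mod_p (s t z : R) :
  s \in teich q xi -> t \in teich q xi -> s - t = p%:R * z -> s = t.
Proof.
move=> /teichP Ts /teichP Tt E.
have pRst : s - t \in pR by rewrite E imset_f.
have pRN x : (- x \in pR) = (x \in pR) by rewrite -!annihilator_p mulrN oppr_eq0.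
have pRxi n : xi ^+ n \notin pR by have [y] := xi_unit n; apply: unit_notin_pR.
case: Ts => [s0|[m sE]]; case: Tt => [t0|[n tE]].
- by rewrite s0.
- by move: pRst; rewrite s0 sub0r pRN tE (negPf (pRxi n)).
- by move: pRst; rewrite t0 subr0 sE (negPf (pRxi m)).
have [y ty] := xi_unit n; pose u := s * y.
have uq : u ^+ (q - 1) = 1.
  by rewrite -[LHS]mul1r -{1}(xi_order n) -exprMn /u mulrCA ty mulr1 sE xi_order.
have [u1|u1] := eqVneq u 1.
  by rewrite -[s]mulr1 -ty mulrCA -/u u1 mulr1 tE.
have [w uw] := unity_root_sub1_unit uq u1.
suff /negP[] : s - t \notin pR by [].
rewrite -pRN opprB; apply: (@unit_notin_pR _ (y * w)).
by rewrite mulrA mulrBl {1}tE ty -/u.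
Qed.

(** The sums t + z are pairwise distinct for t in the Teichmuller set and z in
    (p), and q * q of them fill the ring. *)
Lemma teich_decomposition (x : R) :
  exists t z, t \in teich q xi /\ x = t + p%:R * z.
Proof.
pose D := setX (teich q xi) pR.
have inj : {in D &, injective (fun u : R * R => u.1 + u.2)}.
  move=> [s y] [t z] /setXP[/= Ts /imsetP[y' _ yE]] /setXP[/= Tt /imsetP[z' _ zE]].
  move=> /= E; have st : s = t.
    apply: (@teich_inj_mod_p s t (z' - y')) => //.
    rewrite mulrBr -yE -zE; apply/eqP.
    by rewrite subr_eq addrAC eq_sym subr_eq E addrC.
  by move: E; rewrite st => /addrI ->.
have : x \in [set u.1 + u.2 | u in D].
  rewrite (_ : [set _ | _ in D] = setT) ?inE //.
  apply/eqP; rewrite eqEcard subsetT cardsT cardR card_in_imset //.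
  by rewrite cardsX card_teich card_pR expnS expn1 /=.
by case/imsetP=> -[t y] /setXP[/= Tt /imsetP[z _ ->]] ->; exists t, z.
Qed.

Variable k : nat.
Hypothesis k2 : (q - 1 = 2 * k)%N.

Let T_S := teich_sq q xi.

Let k_gt0 : (0 < k)%N. Proof. by case: k k2 q1_gt0 => // ->. Qed.

Let kE : ((q - 1) %/ 2 = k)%N. Proof. by rewrite k2 mulKn. Qed.

Lemma teich_sqP x : reflect (exists n, x = xi ^+ (2 * n)) (x \in T_S).
Proof.
rewrite /T_S /teich_sq kE; apply: (iffP imsetP) => [[i _ ->]|[n ->]]; first by exists i.
exists (Ordinal (ltn_pmod n k_gt0)) => //=.
by rewrite muln_modr -k2 (prim_expr_mod xi_prim).
Qed.

Lemma card_teich_sq : #|T_S| = k.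
Proof.
rewrite /T_S /teich_sq kE card_imset ?card_ord // => i j /eqP.
rewrite (eq_prim_root_expr xi_prim) k2 -!muln_modr eqn_pmul2l //.
by rewrite !modn_small // => /eqP/val_inj.
Qed.

Lemma fpf_units_teich_sq : fpf_units T_S.
Proof.
split=> [|s t Hs|s /teich_sqP[n ->]|].
- by apply/teich_sqP; exists 0%N; rewrite muln0.
- move=> Ht; case/teich_sqP: Hs => m ->; case/teich_sqP: Ht => n ->.
  by apply/teich_sqP; exists (m + n)%N; rewrite -exprD mulnDr.
- exists (xi ^+ (2 * (n * (k - 1)))).
    by apply/teich_sqP; exists (n * (k - 1))%N.
  rewrite -exprD -mulnDr -mulnS subn1 prednK // mulnCA -k2 mulnC.
  by rewrite exprM (prim_expr_order xi_prim) expr1n.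
- move=> _ /teich_sqP[n ->] s1 x; apply: unity_root_fpf s1.
  exact: xi_order.
Qed.

Let nsqE : teich_nsq q xi = dilate xi T_S.
Proof.
rewrite /T_S /teich_nsq /teich_sq /dilate -imset_comp.
by apply: eq_imset => i /=; rewrite addn1 exprS.
Qed.

Let dilateM (c d : R) (A : {set R}) : dilate c (dilate d A) = dilate (c * d) A.
Proof.
by rewrite /dilate -imset_comp; apply: eq_imset => x /=; rewrite mulrA.
Qed.

Lemma p_mul_unit_neq0 (x y : R) : x * y = 1 -> p%:R * x != 0.
Proof. by move=> /unit_notin_pR; rewrite annihilator_p. Qed.

Lemma principal_unit_neq0 (z x y : R) : x * y = 1 -> (1 + p%:R * z) * x != 0.
Proof.
move=> xy; apply/eqP => E; case/eqP: p_neq0.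
have : p%:R * ((1 + p%:R * z) * x) * y = 0 by rewrite E mulr0 mul0r.
by rewrite mulrA mulrDr mulr1 (mulrA p%:R) p2_eq0 mul0r addr0 -mulrA xy mulr1.
Qed.

(** Expanding a = t + p z with t a Teichmuller element, and then the cofactor of
    p, puts a in the form (1 + p alpha) t if a is a unit, and p t' if not.
    According to the parity of the exponent of xi in t or t', this is in one of
    the four kinds of blocks. *)
Lemma EH_orbits : EH q xi p = orbits T_S.
Proof.
have fpf := fpf_units_teich_sq.
have mem_xi n c : dilate (c * xi ^+ n) T_S =
    if odd n then dilate c (teich_nsq q xi) else dilate c T_S.
  have half_sq : xi ^+ (2 * n./2) \in T_S by apply/teich_sqP; exists n./2.
  have := odd_double_half n; rewrite -mul2n nsqE dilateM.
  case: (odd n) => /= nE; rewrite -[in LHS]nE ?add0n.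
    by rewrite add1n exprS mulrA (dilate_mul fpf).
  by rewrite (dilate_mul fpf).
apply/setP=> B; apply/idP/orbitsP.
  have T1 : (1 : R) * 1 = 1 by rewrite mulr1.
  have [y xy] := xi_unit 1; rewrite expr1 in xy.
  rewrite /EH !in_setU !in_set1 nsqE dilateM -!orbA.
  case/or4P=> [/imsetP[al _ ->]|/eqP->|/imsetP[al _ ->]|/eqP->].
  - exists (1 + p%:R * al) => //.
    by rewrite -[X in X != _]mulr1 (principal_unit_neq0 _ T1).
  - by exists p%:R.
  - exists ((1 + p%:R * al) * xi); last exact: dilateM.
    exact: principal_unit_neq0 xy.
  - by exists (p%:R * xi); rewrite // (p_mul_unit_neq0 xy).
case=> a a0 ->; have [t [z [Tt aE]]] := teich_decomposition a.
rewrite /EH !in_setU !in_set1 -!orbA; case/teichP: Tt => [t0|[n tE]].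
  have [t' [z' [Tt' zE]]] := teich_decomposition z.
  have aE' : a = p%:R * t'.
    by rewrite aE t0 add0r zE mulrDr mulrA p2_eq0 mul0r addr0.
  case/teichP: Tt' => [t'0|[n t'E]]; first by rewrite aE' t'0 mulr0 eqxx in a0.
  rewrite aE' t'E mem_xi; apply/or4P.
  by case: odd; [apply: Or44 | apply: Or42].
have [y ty] := xi_unit n.
(* y is the inverse of t, so that a = t * (1 + p * (z * y)); only the residue of
   z * y modulo p matters. *)
have [al [z' [Tal zE]]] := teich_decomposition (z * y).
have aE' : a = (1 + p%:R * al) * xi ^+ n.
  have -> : p%:R * al = p%:R * (z * y).
    by rewrite zE mulrDr (mulrA p%:R) p2_eq0 mul0r addr0.
  rewrite mulrDl mul1r -!mulrA [y * _]mulrC ty mulr1.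
  by rewrite aE tE.
rewrite aE' mem_xi; apply/or4P.
by case: odd; [apply: Or43 | apply: Or41]; apply: imset_f.
Qed.

(** The characteristic is p ^ 2: if n is 0, its gcd with p ^ 2 is 0 as well, and
    neither 1 nor p is 0. *)
Lemma natr_eq0_dvd n : n%:R = 0 :> R -> (p ^ 2 %| n)%N.
Proof.
move=> n0; have p2 : (1 : R) *+ (p ^ 2) = 0.
  by rewrite expnS expn1 natrM.
have [/dvdnP[m nE]|] := boolP (p %| n)%N; last first.
  rewrite -prime_coprime // coprime_sym => co; case/eqP: (oner_neq0 R).
  by apply: (@coprime_mulrn_eq0 _ _ n (p ^ 2)) => //; rewrite coprimeXr.
have [pm|] := boolP (p %| m)%N.
  by rewrite nE expnS expn1 dvdn_mul.
rewrite -prime_coprime // coprime_sym => co; case/eqP: p_neq0.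
apply: (coprime_mulrn_eq0 co); last by rewrite -[LHS]mulr_natl.
by rewrite -mulrnA mulnC -nE.
Qed.

(** If 2 were a Teichmuller square, then u = 2 ^ (p - 1) would satisfy
    u ^ (q - 1) = 1.  By Fermat u is a principal unit, hence u = 1, against the
    hypothesis on p. *)
Lemma two_notin_teich_sq : odd p -> 2 ^ (p - 1) <> 1 %[mod p ^ 2] ->
  1 + 1 \notin T_S.
Proof.
move=> p_odd nW; apply/negP => /teich_sqP[n tE]; apply: nW.
have e_gt0 : (0 < 2 ^ (p - 1))%N by rewrite expn_gt0.
apply/eqP; rewrite eqn_mod_dvd //; apply: natr_eq0_dvd.
have /dvdnP[m mE] : (p %| 2 ^ (p - 1) - 1)%N.
  have co2 : coprime p 2 by rewrite coprime_sym prime_coprime // dvdn2 p_odd.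
  rewrite -(Gauss_dvdr _ co2) mulnBr muln1 -expnS subn1 prednK ?prime_gt0 //.
  rewrite -eqn_mod_dvd; first by apply/eqP; apply: fermat_little.
  by apply: leq_trans (prime_gt1 p_prime) _; apply/ltnW/ltn_expl.
have uE : (2 ^ (p - 1))%:R = 1 + p%:R * m%:R :> R.
  by rewrite -natrM mulnC -mE -{1}(subnKC e_gt0) natrD.
rewrite natrB // uE (principal_unit_torsion coprime_q1) ?subrr //.
rewrite -uE natrX exprAC.
have -> : (2%:R : R) = 1 + 1 by [].
by rewrite tE xi_order expr1n.
Qed.

(** With q - 1 = 24 m, the squares -1 = xi ^ (12 m) and xi ^ (8 m), a primitive
    cube root of unity, have even exponents and so lie in the Teichmuller
    squares. *)
Lemma EH_intersection : odd p -> 2 ^ (p - 1) <> 1 %[mod p ^ 2] ->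
    q = 1 %[mod 24] ->
  exists B C, [/\ B \in dev (EH q xi p), C \in dev (EH q xi p)
                & #|B :&: C| = 2 %[mod 6]].
Proof.
move=> p_odd nW q_mod24; exists (translate T_S 0), (translate T_S (-1)).
have fpf := fpf_units_teich_sq; have [H1 _ _ fpf1] := fpf.
have T_SE : T_S \in orbits T_S.
  by apply/orbitsP; exists 1; rewrite ?oner_eq0 ?(dilate_id fpf).
rewrite EH_orbits; split; try by apply/devP; exists T_S; eexists.
rewrite (_ : translate T_S 0 = T_S); last first.
  by apply/setP=> x; rewrite mem_translate subr0.
have sq_neq1 n : (0 < n < q - 1)%N -> xi ^+ n != 1.
  case/andP=> n0 nq; rewrite -(prim_order_dvd xi_prim).
  by apply/negP => /(dvdn_leq n0); rewrite leqNgt nq.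
have [m qE] : exists m, (q - 1 = 24 * m)%N by exists ((q - 1) %/ 24)%N; lia.
apply: (@card_self_intersection _ _ fpf (xi ^+ (8 * m))).
- have y1 : xi ^+ (12 * m) != 1 by apply: sq_neq1; lia.
  have Ty : xi ^+ (12 * m) \in T_S.
    by apply/teich_sqP; exists (6 * m)%N; rewrite mulnA.
  suff yE : xi ^+ (12 * m) + 1 = 0 by rewrite -[-1]addr0 -yE addrC addrK.
  apply: (fpf1 _ Ty y1); rewrite mulrDr mulr1 -exprD -mulnDl -qE.
  by rewrite (prim_expr_order xi_prim) addrC.
- exact: two_notin_teich_sq.
- by apply/teich_sqP; exists (4 * m)%N; rewrite mulnA.
- by apply: sq_neq1; lia.
- by rewrite -exprM mulnAC -qE (prim_expr_order xi_prim).
Qed.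

End LocalRing.

(** * The Galois ring is local with maximal ideal (p) *)

Section GaloisRing.

Local Open Scope ring_scope.

Variables (p r : nat) (f : {poly 'Z_(p ^ 2)}).
Hypotheses (p_prime : prime p) (r_gt0 : (0 < r)%N) (f_galois : galois_poly r f).

Let p2_gt1 : (1 < p ^ 2)%N.
Proof. by rewrite -{1}(exp1n 2) ltn_exp2r ?prime_gt1. Qed.

Let natr_Fp_eq0 n : (n%:R == 0 :> 'F_p) = (p %| n)%N.
Proof. by rewrite -(dvdn_pcharf (pchar_Fp p_prime)). Qed.

Lemma reduce_natr n : reduce_mod_p (n%:R : 'Z_(p ^ 2)) = n%:R.
Proof.
rewrite /reduce_mod_p val_Zp_nat // [in RHS](divn_eq n (p ^ 2)) natrD.
rewrite [X in X + _](_ : _ = 0) ?add0r //; apply/eqP.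
by rewrite natr_Fp_eq0 expnS mulnCA dvdn_mulr.
Qed.

Lemma reduce_zmod_morphism : zmod_morphism (@reduce_mod_p p).
Proof.
have red_add (a b : 'Z_(p ^ 2)) : reduce_mod_p (a + b) = reduce_mod_p a + reduce_mod_p b.
  by rewrite -[a]natr_Zp -[b]natr_Zp -natrD !reduce_natr natrD.
by move=> a b; rewrite -[in RHS](subrK b a) [in RHS]red_add addrK.
Qed.

Lemma reduce_monoid_morphism : monoid_morphism (@reduce_mod_p p).
Proof.
split=> [|a b]; first by rewrite -[1]/(1%:R) reduce_natr.
rewrite -[a]natr_Zp -[b]natr_Zp.
by rewrite -natrM !reduce_natr natrM.
Qed.

Let red : {rmorphism 'Z_(p ^ 2) -> 'F_p} :=
  HB.pack (@reduce_mod_p p)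
    (GRing.isZmodMorphism.Build _ _ _ reduce_zmod_morphism)
    (GRing.isMonoidMorphism.Build _ _ _ reduce_monoid_morphism).

Let lift (b : 'F_p) : 'Z_(p ^ 2) := (b : nat)%:R.

Lemma liftK : cancel lift red.
Proof. by move=> b; rewrite /= reduce_natr natr_Zp. Qed.

Lemma reduce_eq0 a : red a = 0 -> exists b, a = p%:R * b.
Proof.
rewrite -[a]natr_Zp /= reduce_natr => /eqP; rewrite natr_Fp_eq0.
by case/dvdnP=> m ->; exists m%:R; rewrite mulnC natrM.
Qed.

Lemma reduce_poly_eq0 g : map_poly red g = 0 -> exists h, g = p%:R * h.
Proof.
move=> g0; have coef_div i : exists b, g`_i == p%:R * b.
  have [b gb] : exists b, g`_i = p%:R * b.
    by apply: reduce_eq0; rewrite -coef_map g0 coef0.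
  by exists b; rewrite gb.
exists (\poly_(i < size g) xchoose (coef_div i)); apply/polyP=> i.
rewrite -polyC_natr coefCM coef_poly; case: ltnP => [_|gi].
  exact/eqP/(xchooseP (coef_div i)).
by rewrite mulr0 nth_default.
Qed.

Let f_mon : f \is monic. Proof. by case: f_galois. Qed.
Let size_f : size f = r.+1. Proof. by case: f_galois. Qed.
Let mk_f : mk_monic f = f.
Proof. by rewrite /mk_monic size_f f_mon /= ltnS r_gt0. Qed.

Lemma card_galois_ring : #|{: galois_ring f}| = ((p ^ r) ^ 2)%N.
Proof.
rewrite card_monic_qpoly ?size_f // card_ord Zp_cast //=.
by rewrite -!expnM mulnC.
Qed.

Lemma galois_ring_p2 : p%:R * p%:R = 0 :> galois_ring f.
Proof.
rewrite -natrM -(rmorph_nat (qpolyC f)) mulnn.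
by rewrite pchar_Zp // rmorph0.
Qed.

Lemma galois_ring_p_neq0 : p%:R != 0 :> galois_ring f.
Proof.
apply/eqP; rewrite -(rmorph_nat (qpolyC f)) => /(congr1 val)/eqP.
rewrite /= polyC_eq0 => /eqP/(congr1 val).
rewrite /= val_Zp_nat // modn_small; first by case: p p_prime.
by rewrite -[X in (X < _)%N]expn1 ltn_exp2l ?prime_gt1.
Qed.

Lemma in_qpoly_modulus : in_qpoly f f = 0.
Proof.
by apply: val_inj; rewrite /= mk_f Pdiv.RingMonic.rmodpp.
Qed.

(** Let g represent x.  Modulo p, either f divides g, and then g vanishes for
    degree reasons, so x is in (p); or f and g are coprime, and lifting a Bezout
    relation makes x invertible modulo (p), hence invertible since (p) has
    square zero. *)
Lemma galois_ring_local (x : galois_ring f) :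
  (exists y, x = p%:R * y) \/ (exists y, x * y = 1).
Proof.
have f_irr : irreducible_poly (map_poly red f) by case: f_galois.
pose g : {poly 'Z_(p ^ 2)} := val x.
have xE : x = in_qpoly f g.
  by apply: val_inj; rewrite /= Pdiv.CommonRing.rmodp_small ?size_mk_monic.
have size_g : (size g < size f)%N.
  have : (size g < size (mk_monic f))%N := size_mk_monic x.
  by rewrite mk_f.
have [co|] := boolP (coprimep (map_poly red f) (map_poly red g)); last first.
  rewrite irreducible_poly_coprime // negbK => dv; left.
  have [|h gE] := reduce_poly_eq0 (g := g).
    apply/eqP; apply: contraTT dv => g0; apply/negP => /(dvdp_leq g0).
    have -> : size (map_poly red f) = size f.
      by rewrite size_map_poly_id0 // (monicP f_mon) rmorph1 oner_eq0.
    by rewrite leqNgt map_polyE (leq_ltn_trans (size_Poly _)) ?size_map.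
  by exists (in_qpoly f h); rewrite xE gE rmorphM rmorph_nat.
right; case/Bezout_coprimepP: co => -[u v] /= /eqpP[[c d] /andP[/= c0 d0]].
move=> E.
pose u' := map_poly lift (d^-1 *: (c *: u)).
pose v' := map_poly lift (d^-1 *: (c *: v)).
have lift_polyK w : map_poly red (map_poly lift w) = w.
  by apply: map_polyK; [exact: liftK | exact: rmorph0].
have [|h hE] := reduce_poly_eq0 (g := u' * f + v' * g - 1).
  rewrite rmorphB rmorphD !rmorphM rmorph1 /u' /v' /= !lift_polyK.
  by rewrite -!scalerAl -!scalerDr E scalerA mulVf // scale1r subrr.
have := congr1 (in_qpoly f) hE.
rewrite !(rmorphB, rmorphD, rmorphM, rmorph1, rmorph_nat).
rewrite /= in_qpoly_modulus.
rewrite mulr0 add0r -xE; set y := in_qpoly f v'; set z := in_qpoly f h => yxE.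
exists (y * (1 - p%:R * z)); rewrite mulrA [x * y]mulrC.
have -> : y * x = 1 + p%:R * z by rewrite -yxE addrC subrK.
have -> : (1 + p%:R * z) * (1 - p%:R * z) = 1 - p%:R * p%:R * z ^+ 2 by ring.
by rewrite galois_ring_p2 mul0r subr0.
Qed.

End GaloisRing.

(** * The two designs *)

Lemma orbit_designs (R : finComNzRingType) (H : {set R}) v k lambda :
    fpf_units H -> #|R| = v -> #|H| = k -> 1 < k -> coprime k v ->
    lambda = k - 1 ->
  disjoint_difference_family v k lambda (orbits H)
  /\ design2 v k lambda (dev (orbits H)).
Proof.
move=> fpfH <- <- H_gt1 co_HR ->; split.
  exact: orbits_difference_family.
exact: dev_orbits_design2.
Qed.

Lemma design_parameters q (k := (q - 1) %/ 2) :
    1 < q -> q - 1 = 0 %[mod 24] ->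
  [/\ q = 1 %[mod 24], q - 1 = 2 * k, (q - 3) %/ 2 = k - 1, 1 < k
    & 2 * (q + 1) * k = q ^ 2 - 1].
Proof.
move=> q_gt1 q_mod24; have k2 : q - 1 = 2 * k by rewrite /k; lia.
by split; rewrite ?k2 //; [lia | rewrite /k; lia | rewrite /k; lia | nia].
Qed.

Theorem theorem4p12 (p r : nat) (p_prime : prime p) (p_odd : odd p)
    (p_nonwieferich : 2 ^ (p - 1) <> 1 %[mod p ^ 2])
    (r_gt0 : 0 < r)
    (F : finFieldType) (card_F : #|F| = p ^ (2 * r))
    (f : {poly 'Z_(p ^ 2)}) (f_galois : galois_poly r f)
    (xi : galois_ring f) (xi_gen : (p ^ r - 1).-primitive_root%R xi)
    (pr_mod24 : p ^ r - 1 = 0 %[mod 24]) :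
  let v := p ^ (2 * r) in
  let k := (p ^ r - 1) %/ 2 in
  let lambda := (p ^ r - 3) %/ 2 in
  let C := CH F (p ^ r) in
  let E := EH (p ^ r) xi p in
  [/\ disjoint_difference_family v k lambda C,
      disjoint_difference_family v k lambda E,
      design2 v k lambda (dev C)
    & design2 v k lambda (dev E)]
  /\ ~ designs_isomorphic (dev E) (dev C).
Proof.
move=> v k lambda C E; set q := p ^ r in xi_gen pr_mod24 k lambda C E *.
have q_gt1 : 1 < q by rewrite -(exp1n r) ltn_exp2r ?prime_gt1.
have p_dvd_q : p %| q by apply: dvdn_exp.
have vE : v = q ^ 2 by rewrite /v mulnC expnM.
have [q_mod24 k2 lambdaE k_gt1 indexE] := design_parameters q_gt1 pr_mod24.
rewrite -/k -/lambda in k2 lambdaE k_gt1 indexE.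
have co_kv : coprime k v.
  rewrite vE coprimeXr // (coprime_dvdl (_ : k %| q - 1)) //.
    by rewrite k2 dvdn_mull.
  by rewrite subn1 coprimePn // ltnW.
have cardF : #|F| = q ^ 2 by rewrite card_F.
have q_pchar : [pchar F]%R.-nat q.
  by rewrite pnatX pnatE // (card_finPcharP card_F p_prime).
have CE : C = orbits [set x : F | x ^+ k == 1]%R.
  by rewrite /C /CH (@powersE _ _ k) // cardF.
have [p2_eq0 p_neq0] := (galois_ring_p2 f p_prime, galois_ring_p_neq0 f p_prime).
have localR := galois_ring_local p_prime r_gt0 f_galois.
have cardR : #|{: galois_ring f}| = q ^ 2.
  exact: card_galois_ring r_gt0 f_galois.
have EE := EH_orbits p_prime q_gt1 p_dvd_q p2_eq0 p_neq0 localR cardR xi_gen k2.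
rewrite -/E in EE.
have [C_family C_design] : disjoint_difference_family v k lambda C
    /\ design2 v k lambda (dev C).
  rewrite CE; apply: orbit_designs => //.
  - exact: fpf_units_unity_roots (ltnW k_gt1).
  - by apply: card_unity_roots; rewrite cardF -indexE dvdn_mull.
have [E_family E_design] : disjoint_difference_family v k lambda E
    /\ design2 v k lambda (dev E).
  have fpfT := fpf_units_teich_sq p_prime q_gt1 p_dvd_q p2_eq0 localR xi_gen k2.
  rewrite EE; apply: (orbit_designs fpfT) => //; first by rewrite vE.
  exact: (card_teich_sq xi_gen k2).
split=> // iso.
have [A [B [EA EB AB]]] : exists A B, [/\ A \in dev E, B \in dev E
    & #|A :&: B| = 2 %[mod 6]] 
  by exact: (EH_intersection p_prime q_gt1 p_dvd_q p2_eq0 p_neq0 localR cardR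
            xi_gen k2 p_odd p_nonwieferich q_mod24).
have [A' [B' [CA CB A'B']]] := designs_isomorphic_card_setI iso EA EB.
rewrite CE in CA CB.
have := dev_orbits_intersection_mod6 k2 cardF q_pchar q_mod24 q_gt1 CA CB.
by rewrite A'B' AB.
Qed.
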